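(* Fix an integer $r\ge1$. For each $n$ let $X$ be a random subcomplex of the standard simplex $\Delta_n$ on the vertex set $\{1,\dots,n\}$ with distribution $\mathbb P(X)=2^{-H(X)}$, $H(X)=|F(X)|+|E(X)|$. Then the probability that $X$ is $r$-ample tends to $1$ as $n\to\infty$.
   Context: A subcomplex $X\subseteq\Delta_n$ is any simplicial complex whose simplexes are nonempty subsets of $\{1,\dots,n\}$. $F(X)$ is the set of simplexes of $X$; $E(X)$ is the set of simplexes $\sigma$ of $\Delta_n$ with $\sigma\notin X$ but all proper nonempty faces of $\sigma$ in $X$. $\mathbb P(X)=2^{-H(X)}$ is a probability measure on subcomplexes of $\Delta_n$. For $U\subseteq V(X)$, $X_U$ is the induced subcomplex on $U$; $\mathrm{Lk}_X(v)$ is the subcomplex of simplexes $\sigma$ with $v\notin\sigma$, $\sigma\cup\{v\}\in X$. A nonempty simplicial complex $X$ is $r$-ample if for every $U\subseteq V(X)$ with $|U|\le r$ and every subcomplex $A\subseteq X_U$ (possibly empty) there exists $v\in V(X)\setminus U$ with $\mathrm{Lk}_X(v)\cap X_U=A$. *)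

(* Defs.v *)
From HB Require Import structures.
From mathcomp Require Import all_boot all_order all_algebra.

Set Implicit Arguments.
Unset Strict Implicit.
Unset Printing Implicit Defensive.

Import Order.TTheory GRing.Theory Num.Theory.
Local Open Scope ring_scope.

Section Complexes.
Variable T : finType.
Implicit Types (X A : {set {set T}}) (U s t : {set T}) (v : T).

(* A simplicial complex with vertices among the points of [T] is represented by
   its set of simplexes; the empty complex is allowed, and a point of [T] need
   not be a vertex. *)
Definition is_complex X : bool :=
  (set0 \notin X) &&
  [forall s in X, forall t, (t != set0) && (t \subset s) ==> (t \in X)].

Record subcomplex := Subcomplex {
  simplexes :> {set {set T}};
  _ : is_complex simplexes }.

HB.instance Definition _ := [isSub for simplexes].
HB.instance Definition _ := [Finite of subcomplex by <:].

Definition vertices X : {set T} := [set v | [set v] \in X].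

(* In particular, a point of [T] that is not a vertex of [X] gives an
   element [set v] of [external X]. *)
Definition external X : {set {set T}} :=
  [set s | [&& s != set0, s \notin X &
     [forall t, (t != set0) && (t \proper s) ==> (t \in X)]]].

Definition induced X U : {set {set T}} := [set s in X | s \subset U].

Definition link X v : {set {set T}} :=
  [set s in X | (v \notin s) && (v |: s \in X)].

Definition ample (r : nat) X : bool :=
  (X != set0) &&
  [forall U : {set T}, (U \subset vertices X) && (#|U| <= r)%N ==>
    [forall A : {set {set T}}, is_complex A && (A \subset induced X U) ==>
      [exists v, (v \in vertices X :\: U) &&
                 (link X v :&: induced X U == A)]]].

Definition energy X : nat := (#|X| + #|external X|)%N.

End Complexes.

Definition complex_law (R : numFieldType) (T : finType) (X : subcomplex T) : R :=
  2 ^- energy X.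

Definition complex_prob (R : numFieldType) (T : finType)
    (P : pred (subcomplex T)) : R :=
  \sum_(X : subcomplex T | P X) complex_law R X.

Section Normalization.
Variable T : finType.
Implicit Types (X S : {set {set T}}) (s t : {set T}).

Let core S : {set {set T}} :=
  [set s | (s != set0) &&
     [forall t, (t != set0) && (t \subset s) ==> (t \in S)]].

Let core_complex S : is_complex (core S).
Proof.
apply/andP; split; first by rewrite inE eqxx.
apply/forall_inP => s; rewrite inE => /andP[_ /forallP sS].
apply/forallP => t; apply/implyP => /andP[t0 ts]; rewrite inE t0 /=.
apply/forallP => u; apply/implyP => /andP[u0 ut].
by apply: (implyP (sS u)); rewrite u0 (subset_trans ut ts).
Qed.

Let core_eq S X : is_complex X ->
  (core S == X) = (X \subset S) && [disjoint external X & S].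
Proof.
move=> /andP[X0 /forall_inP Xd].
have Xn s : s \in X -> s != set0 by apply: contraTneq => ->.
apply/eqP/andP => [SX|[XS XE]].
  split.
    apply/subsetP => s; rewrite -SX inE => /andP[s0 /forallP/(_ s)].
    by rewrite s0 subxx.
  apply/pred0P => s /=; apply/negbTE/negP => /andP[].
  rewrite inE => /and3P[s0 /negP sX /forallP sE] sS; apply: sX.
  rewrite -SX inE s0; apply/forallP => t; apply/implyP => /andP[t0 ts].
  have [->//|ts'] := eqVneq t s.
  have : t \in X.
    by apply: (implyP (sE t)); rewrite t0 properEneq ts' ts.
  by rewrite -SX inE => /andP[_ /forallP/(_ t)]; rewrite t0 subxx.
apply/setP => s; apply/idP/idP.
  elim: {s}#|s| {-2}s (leqnn #|s|) => [|n IH] s.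
    by rewrite leqn0 cards_eq0 => /eqP ->; rewrite inE eqxx.
  move=> sn sS; move: (sS); rewrite inE => /andP[s0 /forallP sc].
  apply: contraT => sX; move/pred0P: XE => /(_ s) /=.
  rewrite (_ : s \in S); last by move: (sc s); rewrite s0 subxx.
  rewrite andbT inE s0 sX /= => /forallP[] t.
  apply/implyP => /andP[t0 ts]; apply: IH.
    by rewrite -ltnS; apply: leq_trans (proper_card ts) sn.
  case/andP: (core_complex S) => _ /forall_inP/(_ _ sS)/forallP/(_ t).
  by rewrite t0 (proper_sub ts).
move=> sX; rewrite inE Xn //=; apply/forallP => t; apply/implyP => tP.
by apply: (subsetP XS); apply: (implyP (forallP (Xd s sX) t)).
Qed.

Let card_interval (A B : {set {set T}}) : [disjoint A & B] ->
  (#|[set S : {set {set T}} | (A \subset S) && [disjoint B & S]]|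
     * 2 ^ (#|A| + #|B|) = 2 ^ #|{set T}|)%N.
Proof.
move=> AB.
have -> : [set S : {set {set T}} | (A \subset S) && [disjoint B & S]]
        = [set (A :|: S) | S in powerset (~: (A :|: B))].
  apply/setP => S; rewrite inE; apply/andP/imsetP => [[AS BS]|[S' S'P ->]].
    exists (S :\: A); last first.
      by rewrite setDE setUIr setUCr setIT; apply/esym/setUidPr.
    rewrite inE; apply/subsetP => s; rewrite !inE => /andP[/negbTE -> sS] /=.
    by rewrite (disjointFl BS sS).
  split; first exact: subsetUl.
  apply/pred0P => s /=; apply/negbTE/negP => /andP[sB]; rewrite inE.
  rewrite (disjointFl AB sB) /= => sS'.
  by move: S'P; rewrite inE => /subsetP/(_ s sS'); rewrite !inE sB orbT.
rewrite card_in_imset; last first.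
  move=> S1 S2; rewrite !inE => /subsetP h1 /subsetP h2 /setP h.
  apply/setP => s; move: (h s) (h1 s) (h2 s); rewrite !inE.
  case: (s \in A) => //= _.
  by do 2 case: (s \in _) => //; move=> a b; [have := a isT | have := b isT].
rewrite card_powerset -expnD; congr (2 ^ _)%N.
by rewrite -(cardsC (A :|: B)) addnC cardsU (disjoint_setI0 AB) cards0 subn0.
Qed.

(* [core S] is the largest complex contained in the family [S], and [core S = X]
   for exactly [2 ^ (#|{set T}| - energy X)] families [S]. *)
Lemma complex_prob_total (R : numFieldType) :
  complex_prob R (@predT (subcomplex T)) = 1.
Proof.
have n0 k : (2 ^+ k : R) != 0 by rewrite expf_neq0 // pnatr_eq0.
apply: (mulIf (n0 #|{set T}|)); rewrite mul1r /complex_prob mulr_suml.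
pose f S := Subcomplex (core_complex S).
have cF : (2 ^ #|{set T}| = \sum_(S : {set {set T}}) 1)%N.
  by rewrite sum1_card -[in RHS]cardsT -powersetT card_powerset cardsT.
rewrite -[in RHS]natrX cF natr_sum.
rewrite (partition_big f predT) //=; apply: eq_bigr => X _.
rewrite -natr_sum -natrX.
have XE : [disjoint X : {set {set T}} & external X].
  by apply/pred0P => s /=; rewrite !inE; case: (s \in _); rewrite ?andbF.
rewrite -(card_interval XE) natrM mulrC natrX mulfK; last exact: n0.
congr _%:R; rewrite -sum1dep_card; apply: eq_bigl => S.
by rewrite -core_eq ?(valP X).
Qed.

End Normalization.

(* Main.v *)
(* If a family [S] of subsets of the [n] points is drawn uniformly at random,
   the largest complex [core S] contained in [S] equals [X] exactly when [S]
   contains [X] and misses [external X]; hence [core S] has the law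
   [2 ^- energy X]. Given a set [U] of at most [r] points and a complex [A] on
   [U], a point [v] outside [U] realises [A] as its link on [U] as soon as,
   among the sets [v |: s] with [s \subset U], the family [S] contains precisely
   those with [s] empty or in [A]. Distinct points [v] involve disjoint
   collections of sets, so all of them fail with probability
   [(1 - 2 ^- (2 ^ #|U|)) ^ (n - #|U|)], and a union bound over [(U, A)] bounds
   the probability of non-ampleness by
   [(n + 1) ^ r * 2 ^ (2 ^ r) * (1 - 2 ^- (2 ^ r)) ^ (n - r)]. *)

Require Import Defs.
From mathcomp Require Import all_boot all_order all_algebra.

Import Order.TTheory GRing.Theory Num.Theory.
Local Open Scope ring_scope.
Set Implicit Arguments.
Unset Strict Implicit.
Unset Printing Implicit Defensive.

Lemma card_bigcup_le (I J : finType) (P : pred J) (E : J -> {set I}) :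
  (#|\bigcup_(j | P j) E j| <= \sum_(j | P j) #|E j|)%N.
Proof.
elim/big_ind2: _ => [|m A n B Am Bn|//]; first by rewrite cards0.
by rewrite (leq_trans (leq_card_setU A B)) ?leq_add.
Qed.

Lemma card_small_sets_le (T : finType) (r : nat) :
  (#|[set U : {set T} | #|U| <= r]| <= #|T|.+1 ^ r)%N.
Proof.
elim: r => [|r IHr].
  rewrite (_ : [set U | _] = [set set0]) ?cards1 //.
  by apply/setP => U; rewrite !inE leqn0 cards_eq0.
pose add (oU : option T * {set T}) :=
  if oU.1 is Some x then x |: oU.2 else oU.2.
pose small := [set U : {set T} | #|U| <= r]%N.
apply: (@leq_trans #|add @: setX setT small|); last first.
  apply: leq_trans (leq_imset_card _ _) _.
  by rewrite cardsX cardsT card_option expnS leq_mul2l IHr orbT.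
apply/subset_leq_card/subsetP => U; rewrite inE => Ur.
have [->|[x xU]] := set_0Vmem U.
  by apply/imsetP; exists (None, set0); rewrite // !inE cards0.
apply/imsetP; exists (Some x, U :\ x); last by rewrite /add /= setD1K.
by move: Ur; rewrite !inE /= (cardsD1 x U) xU.
Qed.

Lemma inv_expr2_le1 (R : numFieldType) (k : nat) : 2 ^- k <= 1 :> R.
Proof. by rewrite invf_le1 ?exprn_gt0 // exprn_ege1 // ler1n. Qed.

Section Trace.
Variable I : finType.
Implicit Types (B C S : {set I}) (E : {set {set I}}).

Lemma setI_overwrite B C S : C \subset B -> (S :\: B :|: C) :&: B = C.
Proof.
by move=> /setIidPl CB; rewrite setIUl setIDAC setDIl setDv setI0 set0U.
Qed.

Lemma setD_overwrite B C S : C \subset B -> (S :\: B :|: C) :\: B = S :\: B.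
Proof. by rewrite -setD_eq0 setDUl setDDl setUid => /eqP ->; rewrite setU0. Qed.

(* [S] is determined by its trace on [B] and its part outside [B], the latter
   encoded as the set with the same part outside [B] and trace [C]. *)
Lemma card_trace B C E : C \subset B ->
    (forall S, (S :\: B \in E) = (S \in E)) ->
  #|E| = (2 ^ #|B| * #|[set S in E | S :&: B == C]|)%N.
Proof.
move=> CB outB; rewrite -card_powerset -cardsX.
pose split S := (S :&: B, S :\: B :|: C).
have split_inj : injective split.
  move=> S1 S2 [eqI eqD]; rewrite -(setID S1 B) -(setID S2 B) eqI.
  by rewrite -(setD_overwrite S1 CB) eqD setD_overwrite.
rewrite -(card_imset _ split_inj); apply/eq_card/setP/setP => -[D S].
rewrite !inE /=; apply/imsetP/and3P => [[S' S'E [-> ->]]|[DB SE /eqP SC]].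
  by rewrite subsetIr setI_overwrite // -outB setD_overwrite ?outB.
exists (S :\: B :|: D); first by rewrite -outB setD_overwrite ?outB.
by rewrite /split setI_overwrite // setD_overwrite // -SC setUC setID.
Qed.

End Trace.

Section UniformProb.
Variables (R : numFieldType) (I : finType).
Implicit Types (B C S : {set I}) (E F : {set {set I}}).

Definition uniform_prob E : R := #|E|%:R / 2 ^+ #|I|.

Lemma uniform_probT : uniform_prob setT = 1.
Proof.
rewrite /uniform_prob -powersetT card_powerset cardsT natrX divff //.
by rewrite expf_neq0 // pnatr_eq0.
Qed.

Lemma uniform_probD E F :
  F \subset E -> uniform_prob (E :\: F) = uniform_prob E - uniform_prob F.
Proof.
move=> FE; rewrite /uniform_prob -mulrBl cardsD (setIidPr FE).
by rewrite natrB ?subset_leq_card.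
Qed.

Lemma uniform_prob_le E F : E \subset F -> uniform_prob E <= uniform_prob F.
Proof.
move=> EF; rewrite ler_pM2r ?invr_gt0 ?exprn_gt0 // ler_nat.
exact: subset_leq_card.
Qed.

Lemma uniform_prob_bigcup_le (J : finType) (P : pred J)
    (E : J -> {set {set I}}) :
  uniform_prob (\bigcup_(j | P j) E j) <= \sum_(j | P j) uniform_prob (E j).
Proof.
rewrite -mulr_suml ler_pM2r ?invr_gt0 ?exprn_gt0 // -natr_sum ler_nat.
exact: card_bigcup_le.
Qed.

Lemma uniform_prob_trace B C E : C \subset B ->
    (forall S, (S :\: B \in E) = (S \in E)) ->
  uniform_prob [set S in E | S :&: B == C] = uniform_prob E / 2 ^+ #|B|.
Proof.
move=> CB outB; rewrite /uniform_prob (card_trace CB outB) natrM natrX.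
by rewrite mulrAC [2 ^+ _ * _]mulrC mulfK // expf_neq0 // pnatr_eq0.
Qed.

Lemma uniform_prob_avoid_traces (J : eqType) (B C : J -> {set I}) (vs : seq J) :
    uniq vs -> {in vs, forall v, C v \subset B v} ->
    {in vs &, forall v w, v != w -> [disjoint B v & B w]} ->
  uniform_prob [set S | all (fun v => S :&: B v != C v) vs]
    = \prod_(v <- vs) (1 - 2 ^- #|B v|).
Proof.
elim: vs => [|v vs IHvs] /=.
  by move=> _ _ _; rewrite big_nil -uniform_probT.
move=> /andP[v_vs uniq_vs] CB disjB; rewrite big_cons.
have vs_cons w : w \in vs -> w \in v :: vs by rewrite inE orbC => ->.
have v_cons := mem_head v vs.
pose E := [set S : {set I} | all (fun w => S :&: B w != C w) vs].
have <- : uniform_prob E = \prod_(w <- vs) (1 - 2 ^- #|B w|).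
  apply: IHvs => // [w /vs_cons|w w' /vs_cons w_vs /vs_cons]; first exact: CB.
  exact: disjB.
have E_off_Bv S : (S :\: B v \in E) = (S \in E).
  rewrite !inE; apply: eq_in_all => w w_vs.
  have v_w : v != w by apply: contraNneq v_vs => ->.
  have /disjoint_setI0 BvBw := disjB _ _ v_cons (vs_cons _ w_vs) v_w.
  by rewrite setIDAC setDE -setIA -setDE (setDidPl _) // -setI_eq0 setIC BvBw.
have -> : [set S | (S :&: B v != C v) && all (fun w => S :&: B w != C w) vs]
    = E :\: [set S in E | S :&: B v == C v].
  by apply/setP => S; rewrite !inE; case: (all _ _); rewrite ?andbT ?andbF.
rewrite uniform_probD; last by apply/subsetP => S; rewrite inE => /andP[].
rewrite (uniform_prob_trace (CB _ v_cons) E_off_Bv).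
by rewrite mulrBl mul1r [_^-1 * _]mulrC.
Qed.

End UniformProb.

Section Core.
Variable T : finType.
Implicit Types (X S : {set {set T}}) (s t : {set T}).

Definition core S : {set {set T}} :=
  [set s | (s != set0) &&
     [forall t, (t != set0) && (t \subset s) ==> (t \in S)]].

Lemma coreP S s :
  reflect (s != set0 /\ forall t, t != set0 -> t \subset s -> t \in S)
          (s \in core S).
Proof.
rewrite inE; apply: (iffP andP) => -[s0 faces]; split=> //.
  by move=> t t0 ts; move/forallP/(_ t): faces; rewrite t0 ts.
by apply/forallP => t; apply/implyP => /andP[]; apply: faces.
Qed.

Lemma complex_face X s t :
  is_complex X -> s \in X -> t != set0 -> t \subset s -> t \in X.
Proof.
move=> /andP[_ /forall_inP faces] /faces/forallP/(_ t)/implyP ts t0 t_s.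
by apply: ts; rewrite t0.
Qed.

Lemma complex_neq0 X s : is_complex X -> s \in X -> s != set0.
Proof. by move=> /andP[X0 _] sX; apply: contraNneq X0 => <-. Qed.

Lemma core_is_complex S : is_complex (core S).
Proof.
apply/andP; split; first by rewrite inE eqxx.
apply/forall_inP => s /coreP[_ faces].
apply/forallP => t; apply/implyP => /andP[t0 ts].
apply/coreP; split=> // u u0 ut; exact: faces u0 (subset_trans ut ts).
Qed.

Lemma core_sub S : core S \subset S.
Proof. by apply/subsetP => s /coreP[s0]; apply. Qed.

Lemma sub_core X S : is_complex X -> X \subset S -> X \subset core S.
Proof.
move=> cX /subsetP XS; apply/subsetP => s sX; apply/coreP; split=> [|t t0 ts].
  exact: complex_neq0 sX.
exact/XS/(complex_face cX sX).
Qed.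

Lemma externalP X s :
  reflect [/\ s != set0, s \notin X
             & forall t, t != set0 -> t \proper s -> t \in X]
          (s \in external X).
Proof.
rewrite inE; apply: (iffP and3P) => -[s0 sX faces]; split=> //.
  by move=> t t0 ts; move/forallP/(_ t): faces; rewrite t0 ts.
by apply/forallP => t; apply/implyP => /andP[]; apply: faces.
Qed.

Lemma external_face X s : s != set0 -> s \notin X ->
  exists2 t, t \in external X & t \subset s.
Proof.
move=> s0 sX; pose nonface t := (t != set0) && (t \notin X).
have [|t tmin ts] := @minset_exists _ nonface s; first exact/andP.
exists t => //; have /andP[t0 tX] := minsetp tmin.
apply/externalP; split=> // u u0 /andP[ut tu].
apply: contraNT tu => uX; rewrite (minsetinf tmin _ ut) //.
by rewrite /nonface u0.
Qed.

Lemma core_eqE X S : is_complex X ->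
  (core S == X) = (S :&: (X :|: external X) == X).
Proof.
move=> cX; apply/eqP/eqP => [<-|traceS].
  rewrite setIUr (setIidPr (core_sub S)); apply/setUidPl/subsetP => s.
  rewrite inE => /andP[sS /externalP[s0 _ faces]].
  apply/coreP; split=> // t t0 ts.
  have [->//|t_neq_s] := eqVneq t s; apply: (subsetP (core_sub S)).
  by apply: faces; rewrite // properEneq t_neq_s.
have XS : X \subset S by rewrite -traceS subsetIl.
apply/eqP; rewrite eqEsubset sub_core // andbT.
apply/subsetP => s /coreP[s0 faces].
apply: contraT => /(external_face s0)[t tE ts]; have /externalP[t0 tX _] := tE.
by move: tX; rewrite -traceS in_setI in_setU tE orbT faces.
Qed.

Definition core_subcomplex S : subcomplex T := Subcomplex (core_is_complex S).

Lemma complex_lawE (R : numFieldType) (X : subcomplex T) :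
  complex_law R X = uniform_prob R [set S | core_subcomplex S == X].
Proof.
have XE : [disjoint X : {set {set T}} & external X].
  by apply/pred0P => s; rewrite !inE; case: (s \in _); rewrite ?andbF.
have -> : [set S | core_subcomplex S == X]
    = [set S in setT | S :&: (X :|: external X) == X].
  by apply/setP => S; rewrite !inE -val_eqE /= core_eqE ?(valP X).
rewrite uniform_prob_trace ?subsetUl // => [|S]; last by rewrite !inE.
by rewrite uniform_probT mul1r cardsU (disjoint_setI0 XE) cards0 subn0.
Qed.

Lemma complex_probE (R : numFieldType) (P : pred (subcomplex T)) :
  complex_prob R P = uniform_prob R [set S | P (core_subcomplex S)].
Proof.
rewrite /complex_prob; under eq_bigr => X _ do rewrite complex_lawE.
rewrite -mulr_suml -natr_sum.
congr (_%:R / _); rewrite -sum1dep_card (partition_big core_subcomplex P) //=.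
apply: eq_bigr => X PX; rewrite -sum1dep_card; apply: eq_bigl => S.
by case: eqP => [->|_]; rewrite ?andbT ?andbF.
Qed.

Lemma complex_prob_predC (R : numFieldType) (P : pred (subcomplex T)) :
  complex_prob R P = 1 - complex_prob R (predC P).
Proof.
rewrite -(complex_prob_total T R) /complex_prob.
by rewrite [X in _ = X - _](bigID P) /= addrK.
Qed.

End Core.

Section Cone.
Variable T : finType.
Implicit Types (F S : {set {set T}}) (U s t : {set T}) (v w : T).

Definition cone v F : {set {set T}} := [set v |: s | s in F].

Lemma setU1_inj_powerset v U : v \notin U ->
  {in powerset U &, injective (fun s => v |: s)}.
Proof.
move=> vU s t; rewrite !inE => sU tU eq_st.
rewrite -(@setU1K _ v s) ?eq_st ?setU1K //.
  by apply: contra vU; apply: (subsetP tU).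
by apply: contra vU; apply: (subsetP sU).
Qed.

Lemma mem_cone v U F s : v \notin U -> F \subset powerset U -> s \subset U ->
  (v |: s \in cone v F) = (s \in F).
Proof.
move=> vU FU sU; apply/imsetP/idP => [[t tF eq_st]|sF]; last by exists s.
suff -> : s = t by [].
have tU := subsetP FU t tF.
by apply: (setU1_inj_powerset vU) eq_st => //; rewrite powersetE.
Qed.

Lemma card_cone_powerset v U :
  v \notin U -> #|cone v (powerset U)| = (2 ^ #|U|)%N.
Proof.
by move=> /setU1_inj_powerset inj; rewrite card_in_imset ?card_powerset.
Qed.

Lemma disjoint_cone_powerset v w U : v \notin U -> v != w ->
  [disjoint cone v (powerset U) & cone w (powerset U)].
Proof.
move=> vU v_w; apply/pred0P => s; apply/negP.
move=> /andP[/imsetP[t _ ->] /imsetP[u]].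
rewrite inE => uU eq_vt_wu; have := setU11 v t.
by rewrite eq_vt_wu !inE (negPf v_w); apply/negP/(contra _ vU)/(subsetP uU).
Qed.

Lemma mem_core_setU1 S v s :
  (v |: s \in core S) = ((s == set0) || (s \in core S)) &&
                        [forall (t : {set T} | t \subset s), v |: t \in S].
Proof.
have vt0 t : v |: t != set0 by apply/set0Pn; exists v; rewrite setU11.
apply/idP/andP => [vsS|[sS /forall_inP vS]].
  split; last first.
    apply/forall_inP => t ts; have /coreP[_] := vsS; apply=> //.
    exact: setUS.
  have [//|s0] := eqVneq s set0.
  exact: complex_face (core_is_complex S) vsS s0 (subsetUr _ _).
apply/coreP; split=> // t t0 tvs; have [vt|vt] := boolP (v \in t).
  by rewrite -(setD1K vt) vS // subDset.
have ts : t \subset s.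
  apply/subsetP => u ut; have /setU1P[uv|//] := subsetP tvs u ut.
  by rewrite -uv ut in vt.
case/predU1P: sS ts => [-> |/coreP[_ faces]]; last exact: faces.
by rewrite subset0 (negPf t0).
Qed.

Lemma mem_setU1_trace S v U F s : v \notin U -> F \subset powerset U ->
    S :&: cone v (powerset U) = cone v F -> s \subset U ->
  (v |: s \in S) = (s \in F).
Proof.
move=> vU FU /setP/(_ (v |: s)); rewrite inE => traceS sU; move: traceS.
by rewrite !(mem_cone vU) // powersetE sU andbT.
Qed.

End Cone.

Section Extension.
Variable T : finType.
Implicit Types (X A S : {set {set T}}) (U s t : {set T}) (v : T).

Lemma induced_sub X U : induced X U \subset X.
Proof. by apply/subsetP => s; rewrite inE => /andP[]. Qed.

Lemma induced_sub_powerset X U : induced X U \subset powerset U.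
Proof. by apply/subsetP => s; rewrite !inE => /andP[]. Qed.

Lemma set0U_sub_powerset A U :
  A \subset powerset U -> set0 |: A \subset powerset U.
Proof. by rewrite subUset sub1set powersetE sub0set. Qed.

Definition extends S U A v : bool :=
  S :&: cone v (powerset U) == cone v (set0 |: A).

Lemma mem_core_setU1_extends S U A v s :
    v \notin U -> is_complex A -> A \subset induced (core S) U ->
    extends S U A v -> s \subset U ->
  (v |: s \in core S) = (s \in set0 |: A).
Proof.
move=> vU cA AX /eqP traceS sU.
have A_core := subset_trans AX (induced_sub _ _).
have A_U := subset_trans AX (induced_sub_powerset _ _).
have mem_S := mem_setU1_trace vU (set0U_sub_powerset A_U) traceS.
apply/idP/idP => [/(subsetP (core_sub S))|sA]; first by rewrite mem_S.
rewrite mem_core_setU1; apply/andP; split.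
  by case/setU1P: sA => [->|/(subsetP A_core) ->]; rewrite ?eqxx ?orbT.
apply/forall_inP => t ts; rewrite mem_S ?(subset_trans ts) // !in_setU1.
have [//|t0] := eqVneq t set0; case/setU1P: sA ts => [->|sA ts] /=.
  by rewrite subset0 (negPf t0).
exact: complex_face sA t0 ts.
Qed.

Lemma link_core S U A v :
    v \notin U -> is_complex A -> A \subset induced (core S) U ->
    extends S U A v ->
  v \in vertices (core S) /\ link (core S) v :&: induced (core S) U = A.
Proof.
move=> vU cA AX extS; have vX := mem_core_setU1_extends vU cA AX extS.
split; first by rewrite inE -[[set v]]setU0 vX ?sub0set // setU11.
apply/setP => s; rewrite in_setI; apply/andP/idP => [[]|sA].
  rewrite inE => /and3P[sX vs vsX]; rewrite inE => /andP[_ sU]; move: vsX.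
  by rewrite vX // in_setU1 (negPf (complex_neq0 (core_is_complex S) sX)).
have sXU := subsetP AX s sA; split=> //.
move: sXU; rewrite !inE => /andP[-> sU]; rewrite (contra (subsetP sU v) vU) /=.
by move: (vX s sU); rewrite inE in_setU1 sA orbT.
Qed.

Definition no_extension U A : {set {set {set T}}} :=
  [set S | all (fun v => ~~ extends S U A v) (enum (~: U))].

Lemma no_extensionPn S U A :
  reflect (exists2 v, v \notin U & extends S U A v) (S \notin no_extension U A).
Proof.
rewrite inE; apply: (iffP allPn) => -[v].
  by rewrite mem_enum inE negbK; exists v.
by move=> vU extS; exists v; rewrite ?mem_enum ?inE ?negbK.
Qed.

Lemma ample_core r S :
    (forall U A, (#|U| <= r)%N -> A \subset powerset U ->
       S \notin no_extension U A) ->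
  ample r (core S).
Proof.
move=> ext; apply/andP; split.
  have card0_le : (#|set0 : {set T}| <= r)%N by rewrite cards0.
  have /no_extensionPn[v v0 extS] := ext set0 set0 card0_le (sub0set _).
  have set0_complex : is_complex (set0 : {set {set T}}).
    by rewrite /is_complex inE; apply/forall_inP => s; rewrite inE.
  have [vX _] := link_core v0 set0_complex (sub0set _) extS.
  by apply/set0Pn; exists [set v]; rewrite inE in vX.
apply/forallP => U; apply/implyP => /andP[_ Ur].
apply/forallP => A; apply/implyP => /andP[cA AX].
have A_U := subset_trans AX (induced_sub_powerset _ _).
have /no_extensionPn[v vU extS] := ext U A Ur A_U.
have [vX linkE] := link_core vU cA AX extS.
by apply/existsP; exists v; rewrite in_setD vU vX linkE eqxx.
Qed.

Variable R : numFieldType.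

Lemma uniform_prob_no_extension U A : A \subset powerset U ->
  uniform_prob R (no_extension U A) = (1 - 2 ^- (2 ^ #|U|)) ^+ #|~: U|.
Proof.
move=> /set0U_sub_powerset A0_U.
rewrite uniform_prob_avoid_traces ?enum_uniq // => [|v _|v w].
- rewrite big_enum /= -prodr_const; apply: eq_bigr => v.
  by rewrite inE => vU; rewrite card_cone_powerset.
- exact: imsetS.
- by rewrite !mem_enum !inE => vU _; apply: disjoint_cone_powerset.
Qed.

Lemma uniform_prob_no_extension_le r U A :
    (#|U| <= r)%N -> A \subset powerset U ->
  uniform_prob R (no_extension U A) <= (1 - 2 ^- (2 ^ r)) ^+ (#|T| - r).
Proof.
move=> Ur A_U; rewrite uniform_prob_no_extension // [#|~: U|]cardsCs setCK.
apply: (@le_trans _ _ ((1 - 2 ^- (2 ^ r)) ^+ (#|T| - #|U|))).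
  apply: lerXn2r; rewrite ?nnegrE ?subr_ge0 ?inv_expr2_le1 // lerD2l lerN2.
  by rewrite lef_pV2 ?posrE ?exprn_gt0 // ler_weXn2l ?ler1n // leq_exp2l.
apply: ler_wiXn2l; last exact: leq_sub2l.
  by rewrite subr_ge0 inv_expr2_le1.
by rewrite gerBl invr_ge0 exprn_ge0.
Qed.

Lemma not_ample_core_sub r :
  [set S : {set {set T}} | ~~ ample r (core S)]
    \subset \bigcup_(U : {set T} | (#|U| <= r)%N)
              \bigcup_(A in powerset (powerset U)) no_extension U A.
Proof.
apply/subsetP => S; rewrite inE; apply: contraR => S_notin.
apply: ample_core => U A Ur A_U; apply: contra S_notin => SUA.
by apply/bigcupP; exists U => //; apply/bigcupP; exists A; rewrite ?powersetE.
Qed.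

Lemma not_ample_prob_le r :
  complex_prob R (fun X : subcomplex T => ~~ ample r X)
    <= (#|T|.+1 ^ r * 2 ^ 2 ^ r)%:R * (1 - 2 ^- (2 ^ r)) ^+ (#|T| - r).
Proof.
set q : R := (1 - 2 ^- (2 ^ r)) ^+ (#|T| - r).
have q0 : 0 <= q by rewrite exprn_ge0 // subr_ge0 inv_expr2_le1.
rewrite complex_probE.
apply: le_trans (uniform_prob_le R (not_ample_core_sub r)) _.
apply: le_trans (uniform_prob_bigcup_le _ _ _) _.
apply: (@le_trans _ _ (\sum_(U : {set T} | (#|U| <= r)%N) (2 ^ 2 ^ r)%:R * q)).
  apply: ler_sum => U Ur; apply: le_trans (uniform_prob_bigcup_le _ _ _) _.
  apply: (@le_trans _ _ (\sum_(A in powerset (powerset U)) q)).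
    apply: ler_sum => A; rewrite powersetE.
    exact: uniform_prob_no_extension_le.
  rewrite sumr_const -[q *+ _]mulr_natl ler_wpM2r //.
  by rewrite ler_nat !card_powerset !leq_exp2l.
rewrite sumr_const -[X in X <= _]mulr_natl mulrA -natrM ler_wpM2r //.
by rewrite ler_nat leq_mul2r -cardsE card_small_sets_le orbT.
Qed.

End Extension.

From mathcomp Require Import all_classical all_reals all_analysis.
Import numFieldNormedType.Exports.
Local Open Scope classical_set_scope.
Local Open Scope ring_scope.

(* With [h := 1 - `|q|], [`|q| <= expR (- h)] and [expR x >= x ^+ k.+1 / k.+1`!]
   bound the sequence by [k.+1`! / h ^+ k.+1 / n]. *)
Lemma natrX_geometric_cvg0 (R : realType) (k : nat) (q : R) : `|q| < 1 ->
  (fun n : nat => n%:R ^+ k * q ^+ n) @ \oo --> (0 : R).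
Proof.
move=> q1; pose h := 1 - `|q|; have h0 : 0 < h by rewrite subr_gt0.
pose C := k.+1`!%:R / h ^+ k.+1; rewrite -cvg_shiftS; apply/norm_cvg0P.
have bound_cvg0 : (fun n => C * harmonic n) @ \oo --> (0 : R).
  by rewrite -(mulr0 C); apply: cvgM; [exact: cvg_cst|exact: cvg_harmonic].
apply: squeeze_cvgr (cvg_cst (0 : R)) bound_cvg0; apply: nearW => n.
have n0 : 0 < n.+1%:R :> R by [].
have nh0 : 0 <= n.+1%:R * h by rewrite mulr_ge0 // ltW.
have qX : `|q| ^+ n.+1 <= (expR (n.+1%:R * h))^-1.
  rewrite -expRN -mulrN expRM_natl lerXn2r ?nnegrE ?expR_ge0 //.
  by apply: le_trans (expR_ge1Dx _); rewrite /h opprB addrC subrK.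
have nhX : (n.+1%:R * h) ^+ k.+1 <= k.+1`!%:R * expR (n.+1%:R * h).
  rewrite -ler_pdivrMl ?ltr0n ?fact_gt0 // mulrC.
  by apply: le_trans (expR_ge1Dxn k _); rewrite ?lerDr.
rewrite normr_ge0 normrM !normrX ger0_norm //= ler_pdivlMr // mulrAC -exprSr.
rewrite ler_pdivlMr ?exprn_gt0 // mulrAC -exprMn.
apply: le_trans (ler_pM _ _ nhX qX) _; rewrite ?exprn_ge0 //.
by rewrite mulfK ?gt_eqF ?expR_gt0.
Qed.

Lemma natrX_geometric_subn_cvg0 (R : realType) (k m : nat) (q : R) :
    q != 0 -> `|q| < 1 ->
  (fun n : nat => n.+1%:R ^+ k * q ^+ (n - m)) @ \oo --> (0 : R).
Proof.
move=> q0 q1.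
have shifted : (fun n => q ^- m.+1 * (n.+1%:R ^+ k * q ^+ n.+1)) @ \oo
    --> (0 : R).
  rewrite -(mulr0 (q ^- m.+1)); apply: cvgM; first exact: cvg_cst.
  by have := natrX_geometric_cvg0 k q1; rewrite -cvg_shiftS.
apply: cvg_trans shifted; apply: near_eq_cvg; near=> n.
have mn : (m <= n)%N by near: n; exists m.
by rewrite /= mulrC -mulrA -expfB_cond ?(negPf q0) // subSS.
Unshelve. all: by end_near.
Qed.

Theorem theorem3p2 (R : realType) (r : nat) (hr : (1 <= r)%N) :
  (fun n : nat => complex_prob R (fun X : subcomplex 'I_n => ample r X))
    @ \oo --> (1 : R).
Proof.
pose q : R := 1 - 2 ^- (2 ^ r).
have q0 : 0 < q.
  rewrite subr_gt0 invf_lt1 ?exprn_gt0 //.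
  by rewrite exprn_egt1 ?ltr1n // -lt0n expn_gt0.
have q1 : `|q| < 1 by rewrite gtr0_norm // gtrBl invr_gt0 exprn_gt0.
have lower : (fun n => 1 - 2 ^+ (2 ^ r) * (n.+1%:R ^+ r * q ^+ (n - r)))
    @ \oo --> (1 : R).
  rewrite -[X in _ --> X]subr0 -(mulr0 (2 ^+ (2 ^ r))).
  apply: cvgB; first exact: cvg_cst.
  apply: cvgM; first exact: cvg_cst.
  exact: natrX_geometric_subn_cvg0 (lt0r_neq0 q0) q1.
apply: squeeze_cvgr lower (cvg_cst (1 : R)); apply: nearW => n.
rewrite complex_prob_predC gerBl lerD2l lerN2; apply/andP; split; last first.
  by apply: sumr_ge0 => X _; rewrite invr_ge0 exprn_ge0.
apply: le_trans (not_ample_prob_le _ _ _) _.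
by rewrite card_ord -/q natrM !natrX mulrCA mulrA.
Qed.
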